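(* Let $f=\frac1n\sum_{i=1}^n f_i$, let $f$ and the $f_i$ be smooth functions with smoothness constants $L$ and $L_i$ respectively (none assumed convex), let $L_{\max}=\max\{L_i\}_{i=1}^n$, and assume that there exist constants $\rho,\delta>0$ such that $$\mathbb{E}_i[\|\nabla f_i(x)\|^2]\le\rho\,\|\nabla f(x)\|^2+\delta\quad\text{for all }x.$$ Then SGD with $\text{SPS}_{\max}$ with $c>\frac{\rho L}{4L_{\max}}$ and $\gamma_b<\max\left\{\frac{2}{L\rho},\bar\gamma_b\right\}$ converges as $$\min_{k\in[K]}\mathbb{E}\|\nabla f(x^k)\|^2\le\frac{2}{\zeta K}\left(f(x^0)-f(x^* )\right)+\frac{\left(\gamma_b-\alpha+L\gamma_b^2\right)\delta}{\zeta},$$ where $\alpha=\min\left\{\frac{1}{2cL_{\max}},\gamma_b\right\}$, $\zeta=(\gamma_b+\alpha)-\rho\left(\gamma_b-\alpha+L\gamma_b^2\right)$ and $$\bar\gamma_b:=\frac{-(\rho-1)+\sqrt{(\rho-1)^2+\frac{4L\rho(\rho+1)}{2cL_{\max}}}}{2L\rho}.$$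
   Context: The problem is to minimize $f(x)=\frac1n\sum_{i=1}^n f_i(x)$ over $x\in\mathbb{R}^d$. The set of minimizers of $f$ is assumed nonempty and $x^*$ is a minimizer. For each $i$, $f_i^*:=\inf_x f_i(x)$. $\mathbb{E}_i$ is expectation over $i$ uniform in $\{1,\dots,n\}$. It is assumed throughout that $\mathbb{E}_i[f_i(x^* )-f_i^*]=f(x^* )-\mathbb{E}_i[f_i^*]$ is finite. A function is smooth with constant $L$ ($L$-smooth) if its gradient is $L$-Lipschitz. The index set $[K]$ refers to the first $K$ iterates, $k=0,\dots,K-1$. SGD: $x^{k+1}=x^k-\gamma_k\nabla f_i(x^k)$, starting from $x^0$, where at each iteration $k$ the index $i\in\{1,\dots,n\}$ is chosen uniformly at random and $\gamma_k>0$ is the step-size. $\text{SPS}_{\max}$ (bounded stochastic Polyak step-size) with parameters $c>0$ and $\gamma_b>0$: $\gamma_k=\min\left\{\frac{f_i(x^k)-f_i^*}{c\,\|\nabla f_i(x^k)\|^2},\,\gamma_b\right\}$, where $i$ is the index chosen at iteration $k$.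
   Formalization: The bound is asserted only when ζ>0, and ζ>0 is proved for γ_b<γ̄_b; as stated it is false for γ̄_b<γ_b<2/(Lρ), where ζ<0 makes the right side negative (e.g. f=x²/2, L=ρ=δ=c=1, γ_b=3/2, x⁰=0). L, L_max>0 are assumed so that the formulas make sense. *)

(* Defs.v *)
From HB Require Import structures.
From mathcomp Require Import all_boot all_order all_algebra.
From mathcomp Require Import all_classical all_reals all_analysis.
Set Implicit Arguments.
Unset Strict Implicit.
Unset Printing Implicit Defensive.
Import Order.TTheory GRing.Theory Num.Theory.
Import numFieldNormedType.Exports.
Local Open Scope classical_set_scope.
Local Open Scope ring_scope.

(* The norm `|v| that the library puts on 'rV[R]_m is the max norm. *)
Definition enorm (R : realType) (m : nat) (v : 'rV[R]_m) : R :=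
  Num.sqrt (\sum_(j < m) v ord0 j ^+ 2).

Definition grad (R : realType) (m : nat) (g : 'rV[R]_m -> R) (x : 'rV[R]_m) :
    'rV[R]_m :=
  \row_(j < m) 'D_(delta_mx ord0 j) g x.

Definition smooth (R : realType) (m : nat) (L : R) (g : 'rV[R]_m -> R) : Prop :=
  (forall x, differentiable g x) /\
  (forall x y, enorm (grad g x - grad g y) <= L * enorm (x - y)).

Definition avg (R : realType) (n : nat) (a : 'I_n -> R) : R :=
  n%:R^-1 * \sum_(i < n) a i.

(* Meaningful only when g is bounded below: inf is 0 otherwise. *)
Definition infval (R : realType) (m : nat) (g : 'rV[R]_m -> R) : R :=
  inf (range g).

(* When grad g x = 0 the quotient is 0 here (division by zero); the value of
   the step is then irrelevant, as it only multiplies grad g x. *)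
Definition sps_max (R : realType) (m : nat) (c gammab : R)
    (g : 'rV[R]_m -> R) (x : 'rV[R]_m) : R :=
  Num.min ((g x - infval g) / (c * enorm (grad g x) ^+ 2)) gammab.

(* k-th iterate when the function sampled at iteration j is f_ (idx j). *)
Fixpoint sgd_sps (R : realType) (m n : nat) (f_ : 'I_n -> 'rV[R]_m -> R)
    (c gammab : R) (x0 : 'rV[R]_m) (idx : nat -> 'I_n) (k : nat) : 'rV[R]_m :=
  if k is k'.+1 then
    let x := sgd_sps f_ c gammab x0 idx k' in
    x - sps_max c gammab (f_ (idx k')) x *: grad (f_ (idx k')) x
  else x0.

(* Independent indices, each uniform on 'I_n; every subset of 'I_n is an
   event of the target space. *)
Definition iid_uniform (R : realType) (disp : measure_display)
    (T : measurableType disp) (P : probability T R) (n : nat)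
    (xi : nat -> T -> 'I_n) : Prop :=
  [/\ forall k (A : set 'I_n), measurable (xi k @^-1` A),
      forall k (i : 'I_n), P (xi k @^-1` [set i]) = (n%:R^-1)%:E
    & forall (s : seq nat) (A : nat -> set 'I_n), uniq s ->
        P (\bigcap_(k in [set` s]) (xi k @^-1` A k)) =
        (\prod_(k <- s) P (xi k @^-1` A k))%E].

(* The default 0 is neutral: smoothness constants are nonnegative. *)
Definition Lmax (R : realType) (n : nat) (L_ : 'I_n -> R) : R :=
  \big[Num.max/0]_(i < n) L_ i.

Definition alpha (R : realType) (c Lm gammab : R) : R :=
  Num.min (1 / (2 * c * Lm)) gammab.

(* Only a bound with zeta > 0 makes sense (it divides by zeta). For
   rho * L / (4 * Lm) < c this amounts to gammab < gammabar; gammabar is then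
   smaller than 2 / (L * rho), so a step bound in between makes zeta < 0. *)
Definition zeta (R : realType) (rho L c Lm gammab : R) : R :=
  (gammab + alpha c Lm gammab) -
  rho * (gammab - alpha c Lm gammab + L * gammab ^+ 2).

Definition gammabar (R : realType) (rho L c Lm : R) : R :=
  (- (rho - 1) +
   Num.sqrt ((rho - 1) ^+ 2 + (4 * L * rho * (rho + 1)) / (2 * c * Lm)))
  / (2 * L * rho).

(* Main.v *)
Require Import Defs.
From HB Require Import structures.
From mathcomp Require Import all_boot all_order all_algebra.
From mathcomp Require Import all_classical all_reals all_analysis.
From mathcomp Require Import measurable_realfun.
From mathcomp Require Import ring lra.
Import Order.TTheory GRing.Theory Num.Theory.
Import numFieldNormedType.Exports.
Local Open Scope classical_set_scope.
Local Open Scope ring_scope.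

(** Why the bound holds. Three facts are combined.

    - Descent: an [L]-smooth [f] satisfies
      [f (x + d) <= f x + <grad f x, d> + L / 2 * |d|^2] ([descent]). Applied
      to a sampled function along its own gradient, this bounds its
      suboptimality gap from below by [|grad|^2 / (2 Lmax)], so that the
      Polyak step-size lies between [alpha] and [gammab] wherever the sampled
      gradient does not vanish ([alpha_le_sps_max], [sps_max_le]).

    - One step: with [a] the full gradient, [b] the sampled one and [gamma]
      the step, write [-2 <a, b> = |a - b|^2 - |a|^2 - |b|^2] in the descent
      inequality for [f]. Bounding [gamma] by [gammab] in front of [|a - b|^2]
      and of the quadratic term, and by [alpha] in front of [|a|^2 + |b|^2],
      removes the dependence of the step on the sample ([step_decrease]).
      Averaging over the index, with the mean of [b] equal to [a] and the
      growth condition, gives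
      [zeta * |grad f x|^2 <= 2 (f x - mean (f x_next))
                              + (gammab - alpha + L gammab^2) delta]
      ([mean_decrease]).

    - Expectation: the [k]-th iterate is a function of the first [k] sampled
      indices, whose [n ^ k] values are equally likely, so expectations are
      finite averages over histories ([expectation_history]), and the average
      over histories of length [k + 1] is an average over histories of length
      [k] of averages over the last index ([history_meanS]).

    The one-step inequalities then telescope over [k < K], [f] is bounded below
    by its minimum, and the least of [K] numbers is at most their mean. The
    positivity of [zeta] below [gammabar] is a statement on the roots of a
    quadratic polynomial ([zeta_gt0]). *)

(** * Euclidean inner product and the gradient *)

(** The Euclidean inner product, for which [enorm] is the associated norm. *)
Definition dot {R : realType} {m : nat} (u v : 'rV[R]_m) : R :=
  \sum_(j < m) u ord0 j * v ord0 j.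

Lemma enorm_sqr {R : realType} {m : nat} (v : 'rV[R]_m) :
  enorm v ^+ 2 = dot v v.
Proof.
rewrite /enorm sqr_sqrtr; first by apply: eq_bigr => j _; rewrite expr2.
by apply: sumr_ge0 => j _; rewrite sqr_ge0.
Qed.

Lemma enorm_ge0 {R : realType} {m : nat} (v : 'rV[R]_m) : 0 <= enorm v.
Proof. exact: sqrtr_ge0. Qed.

Lemma dotvv_ge0 {R : realType} {m : nat} (v : 'rV[R]_m) : 0 <= dot v v.
Proof. by rewrite -enorm_sqr sqr_ge0. Qed.

Lemma dotC {R : realType} {m : nat} (u v : 'rV[R]_m) : dot u v = dot v u.
Proof. by apply: eq_bigr => j _; rewrite mulrC. Qed.

Lemma dotDl {R : realType} {m : nat} (u v w : 'rV[R]_m) :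
  dot (u + v) w = dot u w + dot v w.
Proof.
by rewrite -big_split; apply: eq_bigr => j _; rewrite mxE mulrDl.
Qed.

Lemma dotZl {R : realType} {m : nat} (a : R) (u v : 'rV[R]_m) :
  dot (a *: u) v = a * dot u v.
Proof. by rewrite mulr_sumr; apply: eq_bigr => j _; rewrite mxE mulrA. Qed.

Lemma dotZr {R : realType} {m : nat} (a : R) (u v : 'rV[R]_m) :
  dot u (a *: v) = a * dot u v.
Proof. by rewrite dotC dotZl dotC. Qed.

Lemma dotBl {R : realType} {m : nat} (u v w : 'rV[R]_m) :
  dot (u - v) w = dot u w - dot v w.
Proof. by rewrite dotDl -scaleN1r dotZl mulN1r. Qed.

Lemma dotBr {R : realType} {m : nat} (u v w : 'rV[R]_m) :
  dot u (v - w) = dot u v - dot u w.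
Proof. by rewrite dotC dotBl !(dotC u). Qed.

Lemma dotvv_eq0 {R : realType} {m : nat} (v : 'rV[R]_m) :
  dot v v = 0 -> v = 0.
Proof.
move=> /eqP; rewrite psumr_eq0; last by move=> j _; rewrite -expr2 sqr_ge0.
move=> /allP v0; apply/rowP => j; rewrite mxE; apply/eqP.
by have := v0 j (mem_index_enum j); rewrite -expr2 sqrf_eq0.
Qed.

(** Young's inequality; it plays the part of Cauchy-Schwarz below. *)
Lemma young {R : realType} {m : nat} (s : R) (u v : 'rV[R]_m) : 0 < s ->
  2 * s * dot u v <= dot u u + s ^+ 2 * dot v v.
Proof.
move=> s0; have := dotvv_ge0 (u - s *: v).
rewrite dotBl !dotBr !dotZl !dotZr (dotC v u); lra.
Qed.

Lemma derive_grad {R : realType} {m : nat} (g : 'rV[R]_m -> R)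
    (x v : 'rV[R]_m) :
  differentiable g x -> 'D_v g x = dot (grad g x) v.
Proof.
move=> dg; rewrite deriveE// {1}[v]row_sum_delta linear_sum.
apply: eq_bigr => j _.
by rewrite linearZ /= mxE deriveE// mulrC (ord1 ord0).
Qed.

Lemma is_derive_line {R : realType} {m : nat} (g : 'rV[R]_m -> R)
    (x d : 'rV[R]_m) (t : R) : differentiable g (x + t *: d) ->
  is_derive t 1 (fun s : R => g (x + s *: d)) (dot (grad g (x + t *: d)) d).
Proof.
move=> dg.
have dl : is_diff t (fun s : R => x + s *: d) ( *:%R ^~ d).
  have := is_diffD (is_diff_cst x t) (is_diff_scalel t d).
  by rewrite add0r.
have dl' : differentiable (fun s : R => x + s *: d) t by exact: ex_diff.
have dgl := differentiable_comp dl' dg.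
apply: DeriveDef; first exact/derivable1_diffP.
rewrite deriveE// (diff_comp dl' dg)//=.
by rewrite diff_val /= scale1r -deriveE// derive_grad.
Qed.

(** * Descent lemma *)

Lemma smoothW {R : realType} {m : nat} (L M : R) (g : 'rV[R]_m -> R) :
  L <= M -> smooth L g -> smooth M g.
Proof.
move=> LM [dg Lg]; split=> // x y; apply: le_trans (Lg x y) _.
by rewrite ler_wpM2r// enorm_ge0.
Qed.

Lemma smooth_dot_le {R : realType} {m : nat} (L : R) (g : 'rV[R]_m -> R)
    (x d : 'rV[R]_m) (t : R) : 0 < L -> 0 < t -> smooth L g ->
  dot (grad g (x + t *: d) - grad g x) d <= L * t * dot d d.
Proof.
move=> L0 t0 [_ Lg]; set u := _ - _.
have Lt0 : 0 < L * t by rewrite mulr_gt0.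
have uu : dot u u <= (L * t) ^+ 2 * dot d d.
  rewrite -!enorm_sqr.
  have -> : (L * t) ^+ 2 * enorm d ^+ 2 = (L * enorm (t *: d)) ^+ 2.
    by rewrite exprMn [RHS]exprMn !enorm_sqr dotZl dotZr; ring.
  rewrite ler_sqr ?nnegrE ?enorm_ge0//; last first.
    by rewrite mulr_ge0 ?enorm_ge0// ltW.
  by have := Lg (x + t *: d) x; rewrite addrAC subrr add0r.
rewrite -(ler_pM2l Lt0); have := young (L * t) u d Lt0; lra.
Qed.

(** The mean value theorem applied to the gap between [g] and its quadratic
    upper model along the segment from [x] to [x + d]. *)
Lemma descent {R : realType} {m : nat} (L : R) (g : 'rV[R]_m -> R)
    (x d : 'rV[R]_m) : 0 < L -> smooth L g ->
  g (x + d) <= g x + dot (grad g x) d + L / 2 * dot d d.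
Proof.
move=> L0 sg; have [dg _] := sg.
pose q (t : R) := g (x + t *: d) - t * dot (grad g x) d
                  - L / 2 * dot d d * t ^+ 2.
pose dq (t : R) := dot (grad g (x + t *: d) - grad g x) d - L * t * dot d d.
have qder (t : R) : is_derive t 1 q (dq t).
  have ? := is_derive_line g x d t (dg _).
  apply: is_derive_eq.
  rewrite /dq dotBl /GRing.scale /=.
  by field.
have [|t t01] := MVT ltr01 (fun t _ => qder t).
  apply: continuous_subspaceT => t.
  by apply: differentiable_continuous; apply/derivable1_diffP; apply: ex_derive.
have /andP[t0 _] : 0 < t < 1 by rewrite in_itv in t01.
have := smooth_dot_le L g x d t L0 t0 sg.
rewrite subr0 mulr1 /q /dq scale1r scale0r addr0.
lra.
Qed.

Lemma infval_le {R : realType} {m : nat} (g : 'rV[R]_m -> R) (x : 'rV[R]_m) :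
  has_lbound (range g) -> infval g <= g x.
Proof. by move=> lbg; apply: ge_inf => //; exists x. Qed.

(** The decrease achieved by a gradient step of length [1 / L] bounds the
    suboptimality gap from below. *)
Lemma grad_sqr_le_gap {R : realType} {m : nat} (L : R) (g : 'rV[R]_m -> R)
    (x : 'rV[R]_m) : 0 < L -> smooth L g -> has_lbound (range g) ->
  dot (grad g x) (grad g x) <= 2 * L * (g x - infval g).
Proof.
move=> L0 sg lbg.
have := descent L g x (- L^-1 *: grad g x) L0 sg.
move/(le_trans (infval_le g _ lbg)); rewrite dotZr !dotZl !dotZr.
set G := dot _ _ => h.
have {}h : infval g <= g x - G / (2 * L).
  suff <- : g x + - L^-1 * G + L / 2 * (- L^-1 * (- L^-1 * G)) =
            g x - G / (2 * L) by [].
  by field; rewrite gt_eqF.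
rewrite mulrC -ler_pdivrMr ?mulr_gt0//; lra.
Qed.

(** * One step of the method *)

Lemma alpha_gt0 {R : realType} (c Lm gammab : R) :
  0 < c -> 0 < Lm -> 0 < gammab -> 0 < alpha c Lm gammab.
Proof. by move=> *; rewrite lt_min divr_gt0 ?mulr_gt0//=. Qed.

Lemma alpha_le {R : realType} (c Lm gammab : R) : alpha c Lm gammab <= gammab.
Proof. by rewrite ge_min lexx orbT. Qed.

Lemma sps_max_le {R : realType} {m : nat} (c gammab : R) (g : 'rV[R]_m -> R)
    (x : 'rV[R]_m) : sps_max c gammab g x <= gammab.
Proof. by rewrite ge_min lexx orbT. Qed.

Lemma alpha_le_sps_max {R : realType} {m : nat} (c Lm gammab : R)
    (g : 'rV[R]_m -> R) (x : 'rV[R]_m) :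
  0 < c -> 0 < Lm -> smooth Lm g -> has_lbound (range g) -> grad g x != 0 ->
  alpha c Lm gammab <= sps_max c gammab g x.
Proof.
move=> c0 L0 sg lbg g0; rewrite /alpha /sps_max le_min2// enorm_sqr.
have G0 : 0 < dot (grad g x) (grad g x).
  rewrite lt_neqAle dotvv_ge0 andbT eq_sym.
  by apply: contra_neq g0; exact: dotvv_eq0.
have gap := grad_sqr_le_gap Lm g x L0 sg lbg.
rewrite ler_pdivlMr ?mulr_gt0// mul1r mulrC ler_pdivrMr ?mulr_gt0//.
have := ler_wpM2l (ltW c0) gap; lra.
Qed.

(** Polarization turns the inner product of the descent lemma into squared
    norms, whose coefficients are then bounded with [alpha <= gamma <= gammab].
    When the sampled gradient [b] vanishes the point does not move, whatever
    the value of [gamma]. *)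
Lemma step_decrease {R : realType} {m : nat} (L al gamma gammab : R)
    (f : 'rV[R]_m -> R) (x b : 'rV[R]_m) :
  0 < L -> smooth L f -> 0 < al -> al <= gammab -> gamma <= gammab ->
  (b != 0 -> al <= gamma) ->
  2 * (f (x - gamma *: b) - f x) <=
    gammab * dot (grad f x - b) (grad f x - b)
    - al * (dot (grad f x) (grad f x) + dot b b) + L * gammab ^+ 2 * dot b b.
Proof.
move=> L0 sf al0 algb ggb alg; set a := grad f x.
have A0 := dotvv_ge0 a; have B0 := dotvv_ge0 b.
have D0 := dotvv_ge0 (a - b).
have [b0|b0] := eqVneq b 0.
  have b0E v : dot v b = 0.
    by rewrite b0 dotC -(scale0r b) dotZl mul0r.
  rewrite b0 scaler0 subr0 subrr mulr0 -b0 dotBl !dotBr (dotC b a) !b0E.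
  have := ler_wpM2r A0 algb; lra.
have {}alg := alg b0.
have := descent L f x (- gamma *: b) L0 sf; rewrite dotZr !dotZl !dotZr -/a.
rewrite scaleNr => dec.
have E : dot (a - b) (a - b) = dot a a + dot b b - 2 * dot a b.
  by rewrite dotBl !dotBr (dotC b a); ring.
have h1 := ler_wpM2r D0 ggb.
have h2 : al * (dot a a + dot b b) <= gamma * (dot a a + dot b b).
  by apply: ler_wpM2r => //; exact: addr_ge0.
have g2 : gamma ^+ 2 <= gammab ^+ 2.
  by rewrite ler_sqr ?nnegrE ?(le_trans (ltW al0)).
have h3 := ler_wpM2l (ltW L0) (ler_wpM2r B0 g2).
rewrite E in h1 *; lra.
Qed.

(** * Averages over the sampled index *)

Lemma avgD {R : realType} {n : nat} (a b : 'I_n -> R) :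
  avg (fun i => a i + b i) = avg a + avg b.
Proof. by rewrite /avg big_split mulrDr. Qed.

Lemma avgZ {R : realType} {n : nat} (k : R) (a : 'I_n -> R) :
  avg (fun i => k * a i) = k * avg a.
Proof. by rewrite /avg -mulr_sumr mulrCA. Qed.

Lemma avg_cst {R : realType} {n : nat} (k : R) : (0 < n)%N ->
  avg (fun _ : 'I_n => k) = k.
Proof.
move=> n0; rewrite /avg sumr_const card_ord -[k *+ n]mulr_natl mulKf//.
by rewrite pnatr_eq0 -lt0n.
Qed.

Lemma ler_avg {R : realType} {n : nat} (a b : 'I_n -> R) :
  (forall i, a i <= b i) -> avg a <= avg b.
Proof. by move=> ab; rewrite ler_wpM2l ?invr_ge0// ler_sum. Qed.

Lemma dot_grad_avg {R : realType} {m n : nat} (f_ : 'I_n -> 'rV[R]_m -> R)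
    (f : 'rV[R]_m -> R) (x v : 'rV[R]_m) :
  (forall x, f x = avg (fun i => f_ i x)) ->
  (forall i, differentiable (f_ i) x) -> differentiable f x ->
  dot (grad f x) v = avg (fun i => dot (grad (f_ i) x) v).
Proof.
move=> fE df_ df; rewrite -derive_grad//.
have -> : f = n%:R^-1 \*: \sum_(i < n) f_ i.
  by apply/funext => y; rewrite fE /avg /= fct_sumE.
have D i : is_derive x v (f_ i) (dot (grad (f_ i) x) v).
  apply: DeriveDef; first exact: diff_derivable.
  exact: derive_grad.
by rewrite derive_val.
Qed.

(** The function [f] satisfies a Lyapunov inequality for the chain of
    iterates: the mean decrease of [f] in one step controls the squared norm
    of its gradient when [zeta] is positive, up to a multiple of [delta]. *)
Lemma mean_decrease {R : realType} {m n : nat} (f_ : 'I_n -> 'rV[R]_m -> R)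
    (f : 'rV[R]_m -> R) (L Lm rho delta c gammab : R) (x : 'rV[R]_m) :
  (0 < n)%N -> (forall x, f x = avg (fun i => f_ i x)) ->
  (forall i, has_lbound (range (f_ i))) ->
  0 < L -> 0 < Lm -> smooth L f -> (forall i, smooth Lm (f_ i)) ->
  avg (fun i => enorm (grad (f_ i) x) ^+ 2) <=
    rho * enorm (grad f x) ^+ 2 + delta ->
  0 < c -> 0 < gammab ->
  zeta rho L c Lm gammab * enorm (grad f x) ^+ 2 <=
    2 * (f x - avg (fun i =>
           f (x - sps_max c gammab (f_ i) x *: grad (f_ i) x)))
    + (gammab - alpha c Lm gammab + L * gammab ^+ 2) * delta.
Proof.
move=> n0 fE lb L0 Lm0 sf sf_ growth c0 gb0.
set al := alpha c Lm gammab; set a := grad f x.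
set B := avg _ in growth; set F := avg (fun i => f _).
have al0 : 0 < al by exact: alpha_gt0.
have algb : al <= gammab by exact: alpha_le.
have dec i := step_decrease L al (sps_max c gammab (f_ i) x) gammab f x
  (grad (f_ i) x) L0 sf al0 algb (sps_max_le c gammab (f_ i) x)
  (alpha_le_sps_max c Lm gammab (f_ i) x c0 Lm0 (sf_ i) (lb i)).
have aa : dot a a = avg (fun i => dot (grad (f_ i) x) a).
  apply: dot_grad_avg => //; first by move=> i; have [] := sf_ i.
  by have [] := sf.
have : 2 * (F - f x) <= (gammab - al + L * gammab ^+ 2) * B
                        - (gammab + al) * dot a a.
  have := ler_avg _ _ dec; rewrite avgZ avgD avg_cst//.
  move/le_trans; apply.
  rewrite (_ : (fun i => _) = (fun i => (gammab - al + L * gammab ^+ 2) *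
      enorm (grad (f_ i) x) ^+ 2 + (((gammab - al) * dot a a) +
      (- 2 * gammab) * dot (grad (f_ i) x) a))); last first.
    apply/funext => i; rewrite enorm_sqr dotBl !dotBr -/a (dotC a); ring.
  rewrite avgD avgZ -/B avgD avg_cst// avgZ -aa; lra.
have k0 : 0 <= gammab - al + L * gammab ^+ 2.
  by rewrite addr_ge0 ?subr_ge0// mulr_ge0 ?sqr_ge0// ltW.
have := ler_wpM2l k0 growth; rewrite /zeta -/al enorm_sqr; lra.
Qed.

(** * Expectations over the history of sampled indices *)

(** The first [k] sampled indices. *)
Definition history {T : Type} {n : nat} (xi : nat -> T -> 'I_n) (k : nat)
    (w : T) : k.-tuple 'I_n :=
  [tuple xi j w | j < k].

(** The expectation of a function of the first [k] indices when these are
    independent and uniform, that is when all [n ^ k] histories are equally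
    likely. *)
Definition history_mean {R : realType} {n : nat} (k : nat)
    (h : k.-tuple 'I_n -> R) : R :=
  n%:R^-1 ^+ k * \sum_t h t.

(** The index [i0] is only a default value of [nth], never reached. *)
Lemma history_preimage {T : Type} {n : nat} (xi : nat -> T -> 'I_n)
    (i0 : 'I_n) (k : nat) (t : k.-tuple 'I_n) :
  history xi k @^-1` [set t] =
  \bigcap_(j in [set` iota 0 k]) (xi j @^-1` [set nth i0 t j]).
Proof.
apply/seteqP; split=> w /=.
  move=> <- j /=; rewrite mem_iota /= add0n => jk.
  by have := tnth_nth i0 (history xi k w) (Ordinal jk); rewrite tnth_mktuple.
move=> wt; apply: eq_from_tnth => j; rewrite tnth_mktuple (tnth_nth i0).
by apply: wt; rewrite /= mem_iota /= add0n.
Qed.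

Lemma measurable_history {R : realType} {disp : measure_display}
    {T : measurableType disp} {P : probability T R} {n : nat}
    (xi : nat -> T -> 'I_n) (k : nat) (t : k.-tuple 'I_n) (i0 : 'I_n) :
  iid_uniform P xi -> measurable (history xi k @^-1` [set t]).
Proof.
move=> [mxi _ _]; rewrite (history_preimage xi i0).
by apply: fin_bigcap_measurable => [|j _]; [exact: finite_seq|exact: mxi].
Qed.

Lemma probability_history {R : realType} {disp : measure_display}
    {T : measurableType disp} {P : probability T R} {n : nat}
    (xi : nat -> T -> 'I_n) (k : nat) (t : k.-tuple 'I_n) (i0 : 'I_n) :
  iid_uniform P xi -> P (history xi k @^-1` [set t]) = (n%:R^-1 ^+ k)%:E.
Proof.
move=> [_ unif indep]; rewrite (history_preimage xi i0) indep ?iota_uniq//.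
rewrite -[X in _ ^+ X](size_iota 0 k); elim: (iota 0 k) => [|j s IH] /=.
  by rewrite big_nil expr0.
by rewrite big_cons IH unif exprS EFinM.
Qed.

Lemma expectation_history {R : realType} {disp : measure_display}
    {T : measurableType disp} {P : probability T R} {n : nat}
    (xi : nat -> T -> 'I_n) (k : nat) (h : k.-tuple 'I_n -> R) (i0 : 'I_n) :
  iid_uniform P xi -> (forall t, 0 <= h t) ->
  ('E_P[fun w => h (history xi k w)] = (history_mean k h)%:E)%E.
Proof.
move=> iid h0; rewrite unlock.
have mE t := measurable_history xi k t i0 iid.
have hE w : (h (history xi k w))%:E =
    (\sum_t ((h t)%:E * (\1_(history xi k @^-1` [set t]) w)%:E))%E.
  rewrite (bigD1 (history xi k w))//= indicE mem_set// mule1 big1 ?adde0//.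
  move=> t tw; rewrite indicE memNset ?mule0//= => wt.
  by rewrite wt eqxx in tw.
under eq_integral do rewrite hE.
rewrite ge0_integral_sum//; last first.
- by move=> t w _; rewrite mule_ge0// lee_fin.
- by move=> t; apply/measurable_EFinP; exact: measurable_funM.
rewrite /history_mean mulr_sumr -sumEFin; apply: eq_bigr => t _.
rewrite ge0_integralZl_EFin//; last first.
  exact/measurable_EFinP/measurable_indic.
rewrite integral_indic// setIT.
by rewrite [X in (_ * X)%E](probability_history xi k t i0 iid) muleC EFinM.
Qed.

Lemma history_mean0 {R : realType} {n : nat} (h : 0.-tuple 'I_n -> R) :
  history_mean 0 h = h [tuple].
Proof.
rewrite /history_mean expr0 mul1r (bigD1 [tuple])//= big1 ?addr0// => t.
by case/eqP; rewrite (tuple0 t).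
Qed.

Lemma history_meanS {R : realType} {n k : nat} (h : k.+1.-tuple 'I_n -> R) :
  history_mean k.+1 h =
  history_mean k (fun t => avg (fun i => h [tuple of rcons t i])).
Proof.
pose r (p : k.-tuple 'I_n * 'I_n) := [tuple of rcons p.1 p.2].
have rbij : bijective r.
  apply: inj_card_bij; last by rewrite card_prod !card_tuple expnSr card_ord.
  move=> [t i] [t' i'] /(congr1 val) /= /rcons_inj[tt' ->].
  by congr pair; exact: val_inj.
rewrite /history_mean /avg (reindex r) /=; last exact: onW_bij.
by rewrite -mulr_sumr exprSr mulrA pair_bigA.
Qed.

Lemma history_meanD {R : realType} {n k : nat} (g h : k.-tuple 'I_n -> R) :
  history_mean k (fun t => g t + h t) = history_mean k g + history_mean k h.
Proof. by rewrite /history_mean big_split mulrDr. Qed.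

Lemma history_meanB {R : realType} {n k : nat} (g h : k.-tuple 'I_n -> R) :
  history_mean k (fun t => g t - h t) = history_mean k g - history_mean k h.
Proof. by rewrite /history_mean sumrB mulrBr. Qed.

Lemma history_meanZ {R : realType} {n k : nat} (a : R)
    (h : k.-tuple 'I_n -> R) :
  history_mean k (fun t => a * h t) = a * history_mean k h.
Proof. by rewrite /history_mean -mulr_sumr mulrCA. Qed.

Lemma history_mean_cst {R : realType} {n k : nat} (a : R) : (0 < n)%N ->
  history_mean k (fun _ : k.-tuple 'I_n => a) = a.
Proof.
move=> n0; elim: k => [|k IH]; first exact: history_mean0.
by rewrite history_meanS (_ : (fun _ => _) = fun=> a)//; apply/funext => t;
  rewrite avg_cst.
Qed.

Lemma ler_history_mean {R : realType} {n k : nat}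
    (g h : k.-tuple 'I_n -> R) :
  (forall t, g t <= h t) -> history_mean k g <= history_mean k h.
Proof.
by move=> gh; rewrite ler_wpM2l ?exprn_ge0 ?invr_ge0// ler_sum.
Qed.

Lemma sgd_sps_ext {R : realType} {m n : nat} (f_ : 'I_n -> 'rV[R]_m -> R)
    (c gammab : R) (x0 : 'rV[R]_m) (idx idx' : nat -> 'I_n) (k : nat) :
  (forall j, (j < k)%N -> idx j = idx' j) ->
  sgd_sps f_ c gammab x0 idx k = sgd_sps f_ c gammab x0 idx' k.
Proof.
elim: k => [//|k IH] e /=.
by rewrite e// IH// => j jk; apply: e; exact: ltnW.
Qed.

(** * The constant zeta *)

(** With [A = 1 / (2 c Lm)], the bound [gammabar] is the positive root of
    [A (rho + 1) - (rho - 1) x - L rho x ^ 2], which is [zeta] at [x] when the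
    minimum [alpha] is [A]. When it is [gammab], [zeta] is
    [gammab (2 - L rho gammab)] and the lower bound on [c] gives
    [gammab <= A < 2 / (L rho)]. *)
Lemma zeta_gt0 {R : realType} (rho L c Lm gammab : R) :
  0 < rho -> 0 < L -> 0 < c -> 0 < Lm -> 0 < gammab ->
  rho * L / (4 * Lm) < c -> gammab < gammabar rho L c Lm ->
  0 < zeta rho L c Lm gammab.
Proof.
move=> r0 L0 c0 Lm0 g0 cgt; rewrite /gammabar /zeta /alpha.
set A := 1 / (2 * c * Lm).
have A0 : 0 < A by rewrite divr_gt0 ?mulr_gt0.
rewrite (_ : _ / (2 * c * Lm) = 4 * L * rho * (rho + 1) * A); last first.
  by rewrite /A mul1r.
have Lr0 : 0 < 2 * L * rho by rewrite !mulr_gt0.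
set D := _ + _ * A; set s := Num.sqrt D.
have P0 : 0 <= 4 * L * rho * (rho + 1) * A.
  have r1 : 0 <= rho + 1 by lra.
  by apply: mulr_ge0 (ltW A0); apply: mulr_ge0 r1; lra.
have D0 : 0 <= D by rewrite addr_ge0 ?sqr_ge0.
have s2 : s ^+ 2 = D by rewrite sqr_sqrtr.
have s_ge : - (rho - 1) <= s.
  apply: (@le_trans _ _ `|rho - 1|); first by rewrite -normrN ler_norm.
  by rewrite -sqrtr_sqr ler_wsqrtr// lerDl.
rewrite ltr_pdivlMr// => gs.
have [gA|Ag] := leP gammab A.
  have LA : L * rho * A < 2.
    rewrite /A mulrA mulr1 ltr_pdivrMr ?mulr_gt0//.
    move: cgt; rewrite ltr_pdivrMr ?mulr_gt0//; lra.
  have Lg : L * rho * gammab < 2.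
    by apply: le_lt_trans LA; rewrite ler_wpM2l// mulr_ge0 ?ltW.
  have : 0 < gammab * (2 - L * rho * gammab) by rewrite mulr_gt0 ?subr_gt0.
  lra.
pose y := 2 * L * rho * gammab + (rho - 1).
have ys : 0 < (s - y) * (s + y).
  have gL := mulr_gt0 g0 Lr0.
  by apply: mulr_gt0; rewrite /y; lra.
(* completing the square in gammab; here alpha is A *)
have E : 4 * L * rho * (gammab + A - rho * (gammab - A + L * gammab ^+ 2)) =
         (s - y) * (s + y).
  rewrite (_ : (s - y) * (s + y) = s ^+ 2 - y ^+ 2); last by ring.
  by rewrite s2 /D /y; ring.
have Lr4 : 0 < 4 * L * rho by rewrite !mulr_gt0.
by rewrite -(pmulr_rgt0 _ Lr4) E.
Qed.

(** * Convergence *)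

Theorem theorem3p8 (R : realType) (m n : nat)
  (f_ : 'I_n -> 'rV[R]_m -> R) (f : 'rV[R]_m -> R)
  (L : R) (L_ : 'I_n -> R) (rho delta c gammab : R)
  (xstar x0 : 'rV[R]_m)
  (disp : measure_display) (T : measurableType disp) (P : probability T R)
  (xi : nat -> T -> 'I_n) (K : nat)
  (n_gt0 : (0 < n)%N)
  (fE : forall x, f x = avg (fun i => f_ i x))
  (xstar_min : forall x, f xstar <= f x)
  (f_bounded_below : forall i, has_lbound (range (f_ i)))
  (L_gt0 : 0 < L) (Lmax_gt0 : 0 < Lmax L_)
  (f_smooth : smooth L f)
  (f_i_smooth : forall i, smooth (L_ i) (f_ i))
  (rho_gt0 : 0 < rho) (delta_gt0 : 0 < delta)
  (growth : forall x, avg (fun i => enorm (grad (f_ i) x) ^+ 2) <=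
                      rho * enorm (grad f x) ^+ 2 + delta)
  (xi_iid : iid_uniform P xi)
  (c_gt0 : 0 < c) (gammab_gt0 : 0 < gammab)
  (c_gt : rho * L / (4 * Lmax L_) < c)
  (gammab_lt : gammab < Num.max (2 / (L * rho)) (gammabar rho L c (Lmax L_)))
  (K_gt0 : (0 < K)%N) :
  (gammab < gammabar rho L c (Lmax L_) -> 0 < zeta rho L c (Lmax L_) gammab) /\
  (0 < zeta rho L c (Lmax L_) gammab ->
   (\big[Order.min/+oo]_(k < K)
      'E_P[fun w =>
            (enorm (grad f (sgd_sps f_ c gammab x0 (xi ^~ w) k)) ^+ 2)%R]
    <= (2 / (zeta rho L c (Lmax L_) gammab * K%:R) * (f x0 - f xstar) +
        (gammab - alpha c (Lmax L_) gammab + L * gammab ^+ 2) * delta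
        / zeta rho L c (Lmax L_) gammab)%:E)%E).
Proof.
set Lm := Lmax L_; split=> [|z0]; first exact: zeta_gt0.
set z := zeta rho L c Lm gammab in z0 *.
set D := (gammab - _ + _) * delta.
have sf_ i : smooth Lm (f_ i).
  by apply: smoothW (f_i_smooth i); exact: le_bigmax.
pose i0 := Ordinal n_gt0.
(* the k-th iterate, as a function of the history *)
pose X k (t : k.-tuple 'I_n) := sgd_sps f_ c gammab x0 (nth i0 t) k.
have XS k (t : k.-tuple 'I_n) i : X k.+1 [tuple of rcons t i] =
    X k t - sps_max c gammab (f_ i) (X k t) *: grad (f_ i) (X k t).
  rewrite /X /= nth_rcons size_tuple ltnn eqxx.
  rewrite (sgd_sps_ext _ _ _ _ (nth i0 (rcons t i)) (nth i0 t))// => j jk.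
  by rewrite nth_rcons size_tuple jk.
pose F k := history_mean k (fun t => f (X k t)).
pose e k := history_mean k (fun t => enorm (grad f (X k t)) ^+ 2).
have EE k : ('E_P[fun w =>
    (enorm (grad f (sgd_sps f_ c gammab x0 (xi ^~ w) k)) ^+ 2)%R] = (e k)%:E)%E.
  rewrite -(expectation_history xi k _ i0 xi_iid); last first.
    by move=> t; exact: sqr_ge0.
  congr expectation; apply/funext => w; rewrite /X.
  rewrite (sgd_sps_ext _ _ _ _ (xi ^~ w) (nth i0 (history xi k w)))// => j jk.
  by have := tnth_nth i0 (history xi k w) (Ordinal jk); rewrite tnth_mktuple.
have dec k : z * e k <= 2 * (F k - F k.+1) + D.
  have := ler_history_mean _ _ (fun t => mean_decrease f_ f L Lm rho delta c
    gammab (X k t) n_gt0 fE f_bounded_below L_gt0 Lmax_gt0 f_smooth sf_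
    (growth (X k t)) c_gt0 gammab_gt0).
  rewrite history_meanZ -/(e k) -/z => /le_trans; apply.
  rewrite history_meanD history_mean_cst// history_meanZ.
  suff -> : F k.+1 = history_mean k (fun t => avg (fun i =>
      f (X k t - sps_max c gammab (f_ i) (X k t) *: grad (f_ i) (X k t)))).
    by rewrite history_meanB.
  rewrite /F history_meanS; congr history_mean; apply/funext => t.
  by congr avg; apply/funext => i; rewrite XS.
have Fge k : f xstar <= F k.
  rewrite -[f xstar](history_mean_cst (n := n) (k := k))//.
  by apply: ler_history_mean => t; exact: xstar_min.
have F0 : F 0%N = f x0 by rewrite /F history_mean0.
have tele k : z * \sum_(j < k) e j <= 2 * (f x0 - F k) + k%:R * D.
  elim: k => [|k IH].
    by rewrite big_ord0 F0 mulr0 mul0r subrr mulr0 addr0.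
  rewrite big_ord_recr /= mulrDr -natr1; have := dec k; lra.
have KR : 0 < K%:R :> R by rewrite ltr0n.
set B := _ + D / z.
have BE : z * (K%:R * B) = 2 * (f x0 - f xstar) + K%:R * D.
  by rewrite /B; field; rewrite !gt_eqF.
have sumB : \sum_(j < K) e j <= K%:R * B.
  rewrite -(ler_pM2l z0) BE; have := tele K; have := Fge K; lra.
(* the least of the K expectations is at most their average *)
have [k ekB] : exists k : 'I_K, e k <= B.
  apply: contrapT => eB; move: sumB; apply/negP; rewrite -ltNge.
  rewrite mulr_natl -[K in X in X < _]card_ord -sumr_const.
  apply: ltr_sum => [|k _].
    by apply/hasP; exists (Ordinal K_gt0); rewrite ?mem_index_enum.
  by rewrite ltNge; apply/negP => ekB; apply: eB; exists k.
by apply: le_trans (bigmin_le _ k _) _; rewrite EE lee_fin.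
Qed.
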